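(* Let $p$ be a prime and let $q\in\mathbb{C}_p$ with $q\neq 1$ and $|q-1|_p<p^{-1/(p-1)}$. For every $n\in\mathbb{Z}_{+}=\{0,1,2,\dots\}$, $$\beta_{n, q} = \frac{1}{(1-q)^{n}} \sum_{m=0}^{n}\left(\sum_{k=m}^{n}(q-1)^{k-m} \begin{bmatrix} n \\ k\end{bmatrix}_{q} s_{1, q}(k, m)\right)(-1)^{m}\frac{m+1}{[m+1]_{q}},$$ where $\beta_{n,q}$ is the $n$-th Carlitz $q$-Bernoulli number and $s_{1,q}(k,m)$ are the $q$-Stirling numbers of the first kind.
   Context: $\mathbb{C}_p$ is the completion of an algebraic closure of $\mathbb{Q}_p$, with $|p|_p=1/p$; under the assumption on $q$, $q^x=\exp(x\log q)$ for $x\in\mathbb{Z}_p$. Set $[x]_q=\frac{1-q^x}{1-q}$. For $f:\mathbb{Z}_p\to\mathbb{C}_p$ continuously differentiable, the $p$-adic $q$-integral is $\int_{\mathbb{Z}_p} f(x)\,d\mu_q(x)=\lim_{N\to\infty}\frac{1}{[p^N]_q}\sum_{x=0}^{p^N-1}f(x)q^x$. The Carlitz $q$-Bernoulli numbers are $\beta_{n,q}=\int_{\mathbb{Z}_p}[x]_q^n\,d\mu_q(x)$. Also $[n]_q!=\prod_{i=1}^n[i]_q$ and $\begin{bmatrix} n\\k\end{bmatrix}_q=\frac{[n]_q!}{[k]_q![n-k]_q!}$. Let $[x]_{k,q}=[x]_q[x-1]_q\cdots[x-k+1]_q$ (with $[x]_{0,q}=1$). The $q$-Stirling numbers of the first kind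 $s_{1,q}(k,l)$, $0\le l\le k$, are the numbers (independent of $x$) such that $[x]_{k,q}=q^{-\binom{k}{2}}\sum_{l=0}^{k}s_{1,q}(k,l)[x]_q^l$ for all $x$. *)

(* Defs.v *)
From HB Require Import structures.
From mathcomp Require Import all_boot all_order all_algebra.
From mathcomp Require Import all_classical all_reals all_analysis.

Set Implicit Arguments.
Unset Strict Implicit.
Unset Printing Implicit Defensive.

Import Order.TTheory GRing.Theory Num.Theory.

Local Open Scope classical_set_scope.
Local Open Scope ring_scope.

(* Library norms satisfy [`|x *+ n| = `|x| *+ n], which p-adic absolute values
   violate; hence a separate structure, used through the induced metric. *)
Record absval (R : realType) (K : fieldType) := Absval {
  abs :> K -> R ;
  abs_ge0 : forall x, 0 <= abs x ;
  abs_eq0 : forall x, (abs x == 0) = (x == 0) ;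
  absM : forall x y, abs (x * y) = abs x * abs y ;
  abs_ultra : forall x y, abs (x + y) <= Num.max (abs x) (abs y)
}.

(* The field K with the topology and uniformity of the distance |x - y|. *)
Definition valued (R : realType) (K : fieldType) (v : absval R K) : Type := K.

Section ValuedMetric.
Context {R : realType} {K : fieldType} (v : absval R K).

HB.instance Definition _ := GRing.Field.copy (valued v) K.

Let dist (x y : valued v) : R := v (x - y).

Let distxx x : dist x x = 0.
Proof. by apply/eqP; rewrite abs_eq0 subrr. Qed.

Let dist_pos x y : dist x y = 0 -> x = y.
Proof. by move/eqP; rewrite abs_eq0 subr_eq0 => /eqP. Qed.

Let dist_sym x y : dist x y = dist y x.
Proof.
have v1 : v 1 = 1.
  apply: (@mulfI _ (v 1)); first by rewrite abs_eq0 oner_eq0.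
  by rewrite -absM !mulr1.
suff vN1 : v (- 1) = 1 by rewrite /dist -opprB -mulN1r absM vN1 mul1r.
apply/eqP; rewrite -(@eqrXn2 _ 2) ?abs_ge0 ?ler01//.
by rewrite expr2 -absM mulrNN mulr1 v1 expr1n.
Qed.

Let dist_triangle y x z : dist x z <= dist x y + dist y z.
Proof.
rewrite /dist -[x in x - z](subrK y) -addrA.
by rewrite (le_trans (abs_ultra _ _ _))// ge_max lerDl lerDr !abs_ge0.
Qed.

HB.instance Definition _ :=
  isMetric.Build R (valued v) distxx dist_pos dist_sym dist_triangle.

HB.instance Definition _ := isPointed.Build (valued v) 0.

End ValuedMetric.

Section PadicFields.
Context {R : realType} {K : fieldType} (v : absval R K).
Local Notation Kv := (valued v).

(* If |p| = 1/p, the absolute value of K restricts to the p-adic one on the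
   rationals, and if moreover K is complete, the closure of the rationals in K is
   their p-adic completion. *)
Definition padic_rationals : set Kv := closure (range (@ratr Kv)).

Definition padic_integers : set Kv :=
  [set x | padic_rationals x /\ v x <= 1].

Definition padic_algebraic : set Kv :=
  [set x | exists P : {poly Kv},
    [/\ P != 0, forall i, padic_rationals P`_i & root P x]].

(* K is the completion of an algebraic closure of Q_p.  The prime p is
   recovered from the normalisation of the absolute value. *)
Record isCp (p : nat) : Prop := IsCp {
  Cp_normp : v p%:R = p%:R^-1 ;
  Cp_complete : forall F : set_system Kv, ProperFilter F -> cauchy F -> cvg F ;
  Cp_closed : forall P : {poly Kv}, (1 < size P)%N ->
    (forall i, padic_algebraic P`_i) ->
    exists2 x, padic_algebraic x & root P x ;
  Cp_dense : dense padic_algebraic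
}.

End PadicFields.

Section QAnalogues.
Context {R : realType} {K : fieldType} {v : absval R K}.
Local Notation Kv := (valued v).
Implicit Types (q x : Kv) (f : Kv -> Kv) (p k l n m N : nat).

(* [limn] is total; these are meaningful where the series converge, namely
   |x| < p^(-1/(p-1)) for exp and |x - 1| < 1 for log. *)
Definition padic_exp x : Kv := limn [series x ^+ n / n`!%:R]_n.

Definition padic_log x : Kv :=
  limn [series (-1) ^+ n * (x - 1) ^+ n.+1 / n.+1%:R]_n.

Definition qpow q x : Kv := padic_exp (x * padic_log q).

Definition qnum q x : Kv := (1 - qpow q x) / (1 - q).

(* Functions on Z_p are represented by functions on K: only the values at
   natural numbers matter. *)
Definition qintegral p q f : Kv :=
  limn (fun N => (qnum q (p ^ N)%:R)^-1 * \sum_(x < p ^ N) f x%:R * qpow q x%:R).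

Definition carlitz_bernoulli p q n : Kv :=
  qintegral p q (fun x => qnum q x ^+ n).

Definition qfact q n : Kv := \prod_(1 <= i < n.+1) qnum q i%:R.

Definition qbinom q n k : Kv := qfact q n / (qfact q k * qfact q (n - k)).

Definition qfalling q x k : Kv := \prod_(i < k) qnum q (x - i%:R).

(* c l = s_{1,q}(k,l) for l <= k; the values of c beyond k are irrelevant. *)
Definition is_qstirling1 q k (c : nat -> Kv) : Prop :=
  forall x, padic_integers x ->
    qfalling q x k = q ^- 'C(k, 2) * \sum_(l < k.+1) c l * qnum q x ^+ l.

Definition qstirling1 q k l : Kv := xget (fun=> 0) (is_qstirling1 q k) l.

End QAnalogues.

(* Main.v *)
Require Import Defs.
From mathcomp Require Import all_boot all_order all_algebra.
From mathcomp Require Import all_classical all_reals all_analysis.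
From mathcomp Require Import ring.

(* Writing [x]^n q^x as a combination of the powers q^((l+1)x) and summing
   geometric series, the N-th mean of the q-integral becomes a polynomial in
   q^(p^N), which tends to 1; hence
     beta_n = (1-q)^(-n) sum_l C(n,l) (-1)^l (l+1)/[l+1].
   The inner sum of the theorem is C(n,m): compare the coefficients of [x]^m in
     (1 + (q-1)[x])^n = q^(nx) = sum_k (q-1)^k q^C(k,2) [n choose k]_q [x]_k.
   The analytic input is that exp (x log q) interpolates the powers of q, that
   is, exp (log q) = q for |q - 1| < p^(-1/(p-1)). *)

Set Implicit Arguments.
Unset Strict Implicit.
Unset Printing Implicit Defensive.

Import Order.TTheory GRing.Theory Num.Theory.

Local Open Scope classical_set_scope.
Local Open Scope ring_scope.

(** * Gauss binomial expansion *)

Section GaussBinomial.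
Context {F : fieldType} (q : F).
Hypothesis q_neq1 : q != 1.
Implicit Types (n k m : nat).

Definition qint m : F := (1 - q ^+ m) / (1 - q).

Definition qint_fact n : F := \prod_(1 <= i < n.+1) qint i.

(** The Gaussian binomial, given by the q-Pascal rule rather than as a quotient of factorials, so
    that no [i] has to be nonzero. *)
Fixpoint gauss n k : F :=
  match n, k with
  | _, 0%N => 1
  | 0%N, _.+1 => 0
  | n'.+1, k'.+1 => gauss n' k' + q ^+ k * gauss n' k
  end.

(** Since [x - i] = q^(-i) ([x] - [i]), this is q^C(k,2) [x]_k as a polynomial in [x]; its
    coefficients are the q-Stirling numbers. *)
Definition qfalling_poly k : {poly F} := \prod_(i < k) ('X - (qint i)%:P).

Lemma subr1q_neq0 : 1 - q != 0.
Proof. by rewrite subr_eq0 eq_sym. Qed.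

Lemma qintD m n : qint (m + n) = qint m + q ^+ m * qint n.
Proof. by rewrite /qint exprD; field; exact: subr1q_neq0. Qed.

Lemma qint_factS n : qint_fact n.+1 = qint_fact n * qint n.+1.
Proof. by rewrite /qint_fact big_nat_recr. Qed.

Lemma gauss0 n : gauss n 0 = 1.
Proof. by case: n. Qed.

Lemma gaussSS n k : gauss n.+1 k.+1 = gauss n k + q ^+ k.+1 * gauss n k.+1.
Proof. by []. Qed.

Lemma gauss_small n k : (n < k)%N -> gauss n k = 0.
Proof.
elim: n k => [|n IHn] [|k] //; rewrite ltnS => ltnk.
by rewrite gaussSS !IHn ?mulr0 ?addr0// ltnW.
Qed.

(** Induction by the q-Pascal rule; the two terms combine through [k+1] + q^(k+1) [n-k] = [n+1]. *)
Lemma gauss_fact n k : (k <= n)%N ->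
  gauss n k * (qint_fact k * qint_fact (n - k)) = qint_fact n.
Proof.
have f0 : qint_fact 0 = 1 by rewrite /qint_fact big_geq.
elim: n k => [|n IHn] [|k] //; rewrite ?gauss0 ?f0 ?subn0 ?mul1r//.
rewrite ltnS gaussSS => lekn; rewrite subSS mulrDl.
have -> : gauss n k * (qint_fact k.+1 * qint_fact (n - k)) =
    qint_fact n * qint k.+1.
  by rewrite -(IHn _ lekn) qint_factS; ring.
move: lekn; rewrite leq_eqVlt => /orP[/eqP <-|ltkn].
  by rewrite gauss_small// mulr0 mul0r addr0 qint_factS.
have -> : q ^+ k.+1 * gauss n k.+1 * (qint_fact k.+1 * qint_fact (n - k)) =
    qint_fact n * (q ^+ k.+1 * qint (n - k)).
  by rewrite -(IHn _ ltkn) -(subnSK ltkn) (qint_factS (n - k.+1)); ring.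
by rewrite -mulrDr -qintD addSn subnKC ?qint_factS// ltnW.
Qed.

(** As (q-1) [k] = q^k - 1, the new factor (q-1) (X - [k]) is Y - q^k with Y = 1 + (q-1) X. *)
Lemma qfalling_polyS k :
  (q - 1) *: qfalling_poly k.+1 =
  (1 + (q - 1) *: 'X - (q ^+ k)%:P) * qfalling_poly k.
Proof.
rewrite /qfalling_poly big_ord_recr/= mulrC scalerAl; congr (_ * _).
rewrite scalerBr -[_ *: (qint k)%:P]mul_polyC -polyCM.
have -> : (q - 1) * qint k = q ^+ k - 1.
  by rewrite /qint; field; exact: subr1q_neq0.
by rewrite polyCB; ring.
Qed.

(** The q-binomial theorem, expanding Y^n in the products of Y - q^i over i < k, for Y = 1 + (q-1)
    X. *)
Lemma gauss_expansion n :
  (1 + (q - 1) *: 'X) ^+ n =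
  \sum_(k < n.+1) ((q - 1) ^+ k * gauss n k) *: qfalling_poly k.
Proof.
set Y := 1 + _; elim: n => [|n IHn].
  by rewrite big_ord1 /qfalling_poly big_ord0 !mul1r scale1r.
(* Writing Y = (Y - q^k) + q^k, multiplication by Y sends the k-th term to the indices k+1 and k;
   the q-Pascal rule recombines them. *)
have YP k c : Y * (((q - 1) ^+ k * c) *: qfalling_poly k) =
    ((q - 1) ^+ k.+1 * c) *: qfalling_poly k.+1 +
    ((q - 1) ^+ k * (q ^+ k * c)) *: qfalling_poly k.
  have -> : ((q - 1) ^+ k.+1 * c) *: qfalling_poly k.+1 =
      ((q - 1) ^+ k * c) *: ((q - 1) *: qfalling_poly k.+1).
    by rewrite scalerA exprSr mulrAC.
  by rewrite qfalling_polyS -/Y -!mul_polyC !polyCM; ring.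
rewrite exprS IHn mulr_sumr.
under eq_bigr do rewrite YP.
rewrite big_split/=.
rewrite [RHS]big_ord_recl [X in _ + X = _]big_ord_recl/= !gauss0.
rewrite [X in _ + (_ + X) = _](_ : _ =
   \sum_(i < n.+1) ((q - 1) ^+ i.+1 * (q ^+ i.+1 * gauss n i.+1)) *:
     qfalling_poly i.+1).
  rewrite addrCA -big_split/= expr0 !mulr1; congr (_ + _).
  by apply: eq_bigr => i _; rewrite -scalerDl -mulrDr.
rewrite [RHS]big_ord_recr/= gauss_small// !mulr0 scale0r addr0.
by apply: eq_bigr.
Qed.

Lemma size_qfalling_poly k : size (qfalling_poly k) = k.+1.
Proof. rewrite /qfalling_poly -(big_mkord xpredT (fun i => 'X - (qint i)%:P)).
by rewrite size_prod_XsubC size_iota subn0. Qed.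

End GaussBinomial.

(** * Identities for q not a root of unity *)

Section NotRootOfUnity.
Context {F : fieldType} (q : F).
Hypothesis q_nroot : forall m, (0 < m)%N -> q ^+ m != 1.
Implicit Types (n m k : nat).

Let q_neq1 : q != 1. Proof. exact: (q_nroot (isT : 0 < 1)%N). Qed.

Lemma qint_neq0 m : (0 < m)%N -> qint q m != 0.
Proof.
move=> m0; rewrite mulf_neq0 ?invr_neq0//; last exact: subr1q_neq0.
by rewrite subr_eq0 eq_sym q_nroot.
Qed.

Lemma qint_fact_neq0 n : qint_fact q n != 0.
Proof.
elim: n => [|n IHn]; first by rewrite /qint_fact big_geq ?oner_eq0.
by rewrite qint_factS mulf_neq0 ?qint_neq0.
Qed.

(** For i < j the difference [j] - [i] is q^i [j-i], which is nonzero. *)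
Lemma qint_inj : q != 0 -> injective (qint q).
Proof.
move=> q0; suff lt i j : (i < j)%N -> qint q i != qint q j.
  by move=> i j eij; case: (ltngtP i j) => // /lt; rewrite eij eqxx.
move=> ij; rewrite -(subnKC (ltnW ij)) qintD// -subr_eq0 opprD addrA subrr sub0r.
by rewrite oppr_eq0 mulf_neq0 ?expf_neq0 ?qint_neq0// subn_gt0.
Qed.

Lemma gaussE n k : (k <= n)%N ->
  gauss q n k = qint_fact q n / (qint_fact q k * qint_fact q (n - k)).
Proof.
by move=> kn; rewrite -(gauss_fact q_neq1 kn) mulfK ?mulf_neq0 ?qint_fact_neq0.
Qed.

(** Coefficient of X^m in [gauss_expansion], divided by (q-1)^m; the terms k < m drop out because
    the k-th falling polynomial has degree k. *)
Lemma sum_gauss_qfalling_poly n m : (m <= n)%N ->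
  \sum_(m <= k < n.+1) (q - 1) ^+ (k - m) * gauss q n k * (qfalling_poly q k)`_m
  = 'C(n, m)%:R.
Proof.
move=> mn; have q10 : q - 1 != 0 by rewrite subr_eq0.
apply: (mulfI (expf_neq0 m q10)).
have := congr1 (fun P : {poly F} => P`_m) (gauss_expansion q_neq1 n).
rewrite exprDn coef_sum.
under eq_bigr => i _ do
  rewrite expr1n mul1r exprZn coefMn coefZ coefXn mulr_natr.
rewrite coef_sum; under [X in _ = X]eq_bigr => i _ do rewrite coefZ.
rewrite (bigD1 (Ordinal (mn : (m < n.+1)%N)))//= eqxx big1 ?addr0; last first.
  by move=> i im; rewrite -val_eqE eq_sym in im; rewrite (negPf im) mul0rn.
rewrite mulr1n mulr_natr => ->; rewrite -(big_mkord xpredT (fun k =>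
  (q - 1) ^+ k * gauss q n k * (qfalling_poly q k)`_m)).
rewrite [RHS](big_cat_nat _ (n := m)) ?(leqW mn)//= [X in _ = X + _]big_nat.
rewrite [X in _ = X + _]big1 ?add0r; last first.
  move=> k /andP[_ km]; rewrite nth_default ?mulr0//.
  by rewrite size_qfalling_poly.
rewrite mulr_sumr; apply: eq_big_nat => k /andP[mk _].
by rewrite -[X in _ = _ ^+ X * _ * _](subnKC mk) exprD !mulrA.
Qed.

(** Expand (1 - q^x)^n and sum over x the powers of q^(l+1). The quotient (1 - q^((l+1)M)) / (1 -
    q^M) is a geometric sum in q^M, so no denominator is left that vanishes as q^M tends to 1. *)
Lemma mean_qint_pow n M : (0 < M)%N ->
  (qint q M)^-1 * \sum_(x < M) qint q x ^+ n * q ^+ x =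
  ((1 - q) ^+ n)^-1 * \sum_(l < n.+1)
    'C(n, l)%:R * (-1) ^+ l / qint q l.+1 * \sum_(j < l.+1) (q ^+ M) ^+ j.
Proof.
move=> M0; have q10 := subr1q_neq0 q_neq1.
have qM0 : 1 - q ^+ M != 0 by rewrite subr_eq0 eq_sym q_nroot.
have expand x : qint q x ^+ n * q ^+ x = ((1 - q) ^+ n)^-1 *
    \sum_(l < n.+1) 'C(n, l)%:R * (-1) ^+ l * (q ^+ l.+1) ^+ x.
  rewrite /qint expr_div_n -mulrA [_^-1 * q ^+ x]mulrC mulrA mulrC; congr (_ * _).
  rewrite exprDn mulr_suml; apply: eq_bigr => l _.
  rewrite expr1n mul1r -[- q ^+ x]mulN1r exprMn -mulr_natl -!exprM mulSn exprD.
  by rewrite [(l * x)%N]mulnC; ring.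
under eq_bigr do rewrite expand.
rewrite -mulr_sumr mulrCA exchange_big/=; congr (_ * _).
rewrite mulr_sumr; apply: eq_bigr => l _; rewrite -mulr_sumr.
have ql0 : 1 - q ^+ l.+1 != 0 by rewrite subr_eq0 eq_sym q_nroot.
have geom y m : 1 - y != 0 -> \sum_(i < m) y ^+ i = (1 - y ^+ m) / (1 - y) :> F.
  move=> y0; apply: (mulIf y0); rewrite divfK//.
  by rewrite -[RHS]opprB subrX1 -mulNr opprB mulrC.
by rewrite !geom// -!exprM mulnC /qint; field; rewrite qM0 ql0 q10.
Qed.

End NotRootOfUnity.

(** * Ultrametric convergence *)

Section Ultrametric.
Context {R : realType} {K : fieldType} (v : absval R K).
Local Notation Kv := (valued v).
Implicit Types (x y : Kv) (c : R) (n m : nat).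

Lemma v_ge0 x : 0 <= v x. Proof. exact: abs_ge0. Qed.

Lemma v_eq0 x : (v x == 0) = (x == 0). Proof. exact: abs_eq0. Qed.

Lemma vM x y : v (x * y) = v x * v y. Proof. exact: absM. Qed.

Lemma v_gt0 x : (0 < v x) = (x != 0).
Proof. by rewrite lt_def v_eq0 v_ge0 andbT. Qed.

Lemma v0 : v (0 : Kv) = 0. Proof. by apply/eqP; rewrite v_eq0. Qed.

Lemma v1 : v (1 : Kv) = 1.
Proof.
apply: (@mulfI _ (v (1 : Kv))); first by rewrite v_eq0 oner_eq0.
by rewrite -vM !mulr1.
Qed.

Lemma vX x n : v (x ^+ n) = v x ^+ n.
Proof. by elim: n => [|n IHn]; rewrite ?expr0 ?v1// !exprS vM IHn. Qed.

Lemma vV x : v x^-1 = (v x)^-1.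
Proof.
have [->|x0] := eqVneq x 0; first by rewrite invr0 v0 invr0.
by apply: (@mulfI _ (v x)); rewrite ?v_eq0// -vM !divff ?v1 ?v_eq0.
Qed.

Lemma vN x : v (- x) = v x.
Proof.
apply/eqP; rewrite -(@eqrXn2 _ 2) ?v_ge0//.
by rewrite -!vX sqrrN.
Qed.

Lemma v_distC x y : v (x - y) = v (y - x).
Proof. by rewrite -opprB vN. Qed.

Lemma vD_le x y c : v x <= c -> v y <= c -> v (x + y) <= c.
Proof.
by move=> xc yc; rewrite (le_trans (abs_ultra v x y))// ge_max xc yc.
Qed.

Lemma vD_lt x y c : v x < c -> v y < c -> v (x + y) < c.
Proof.
by move=> xc yc; rewrite (le_lt_trans (abs_ultra v x y))// gt_max xc yc.
Qed.

Lemma vB_le x y c : v x <= c -> v y <= c -> v (x - y) <= c.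
Proof. by move=> xc yc; rewrite vD_le ?vN. Qed.

Lemma v_sum_le (I : Type) (r : seq I) (P : pred I) (F : I -> Kv) c :
  0 <= c -> (forall i, P i -> v (F i) <= c) ->
  v (\sum_(i <- r | P i) F i) <= c.
Proof.
move=> c0 Fc; elim/big_ind: _ => [|x y|//]; first by rewrite v0.
exact: vD_le.
Qed.

(** If |x + y| < |x|, then x = (x + y) - y would have absolute value below |x|. *)
Lemma v_dom x y : v y < v x -> v (x + y) = v x.
Proof.
move=> yx; apply/eqP; rewrite eq_le vD_le ?(ltW yx) ?lexx//=.
rewrite leNgt; apply/negP => xyx.
have yx' : v (- y) < v x by rewrite vN.
by have := vD_lt xyx yx'; rewrite addrK ltxx.
Qed.

Lemma v_nat_le1 n : v (n%:R : Kv) <= 1.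
Proof.
by elim: n => [|n IHn]; rewrite ?v0 ?ler01// -natr1 vD_le ?v1.
Qed.

Lemma cvgn_absP (u : nat -> Kv) l :
  u @ \oo --> l <->
  forall e : R, 0 < e -> exists N, forall n, (N <= n)%N -> v (u n - l) < e.
Proof.
rewrite cvg_ballP; split=> cu e /cu.
  by move=> [N _ Nu]; exists N => n /Nu; rewrite ballEmdist /= v_distC.
by move=> [N Nu]; exists N => // n /Nu; rewrite ballEmdist /= v_distC.
Qed.

Lemma limn_eq (u : nat -> Kv) l : u @ \oo --> l -> limn u = l.
Proof. exact/cvg_lim/metric_hausdorff. Qed.

Lemma cvgn_abs_le (u : nat -> Kv) l x c : u @ \oo --> l ->
  (exists N, forall n, (N <= n)%N -> v (u n - x) <= c) -> v (l - x) <= c.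
Proof.
move=> /cvgn_absP ul [N Nc]; rewrite leNgt; apply/negP => cl.
have c0 : 0 <= c := le_trans (v_ge0 _) (Nc N (leqnn N)).
have [M Mu] := ul _ (le_lt_trans c0 cl).
have : v (- (u (maxn M N) - l) + (u (maxn M N) - x)) < v (l - x).
  by rewrite vD_lt// ?vN ?Mu ?leq_maxl// (le_lt_trans (Nc _ _)) ?leq_maxr.
by rewrite opprB addrA subrK ltxx.
Qed.

Lemma series_tail_le (t : nat -> Kv) n m c : 0 <= c -> (n <= m)%N ->
  (forall k, (n <= k)%N -> v (t k) <= c) ->
  v (series t m - series t n) <= c.
Proof.
move=> c0 nm tc; rewrite sub_series nm big_nat_cond v_sum_le// => k.
by rewrite andbT => /andP[/tc].
Qed.

Lemma series_lim_tail_le (t : nat -> Kv) l n c : series t @ \oo --> l ->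
  (forall k, (n <= k)%N -> v (t k) <= c) -> v (l - series t n) <= c.
Proof.
move=> tl tc; apply: (cvgn_abs_le tl); exists n => m nm.
by rewrite series_tail_le// (le_trans (v_ge0 _) (tc n _)).
Qed.

Lemma expr_lt_eps (r e : R) : 0 <= r < 1 -> 0 < e ->
  exists N, forall n, (N <= n)%N -> r ^+ n < e.
Proof.
move=> /andP[r0 r1] e0.
have : r ^+ n @[n --> \oo] --> 0 by apply: cvg_expr; rewrite ger0_norm.
move=> /cvgrPdist_lt /(_ e e0)[N _ Ne]; exists N => n /Ne /=.
by rewrite sub0r normrN ger0_norm// exprn_ge0.
Qed.

Hypothesis complete :
  forall F : set_system Kv, ProperFilter F -> cauchy F -> cvg F.

(** In an ultrametric a tail of a series is bounded by its largest term, here by r^N, so the partial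
    sums are Cauchy. *)
Lemma cvg_series_geometric (t : nat -> Kv) (r : R) : 0 <= r < 1 ->
  (forall n, v (t n) <= r ^+ n) -> series t @ \oo --> limn (series t).
Proof.
move=> r01 tr; apply: complete; apply/cauchy_exP => e e0.
have [N Ne] := expr_lt_eps r01 e0.
exists (series t N); exists N => // m /= Nm.
rewrite ballEmdist /= -[mdist _ _]/(v (series t N - series t m)).
have [r0 r1] := andP r01.
rewrite v_distC (@le_lt_trans _ _ (r ^+ N)) ?Ne//.
rewrite series_tail_le ?exprn_ge0// => k Nk.
by rewrite (le_trans (tr k))// ler_wiXn2l// ltW.
Qed.

End Ultrametric.

(** * The p-adic exponential and logarithm *)

(** Legendre's formula: the floors of (n+1) / p^k, weighted by p - 1, telescope. *)
Lemma logn_fact_le p n : prime p -> (p.-1 * logn p n.+1`! <= n)%N.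
Proof.
move=> pp; rewrite logn_fact//.
(* [maxn 1] in place of the bare quotient gains the unit over [n.+1]. *)
suff S m : (p.-1 * (\sum_(1 <= k < m.+1) n.+1 %/ p ^ k)
    + maxn 1 (n.+1 %/ p ^ m) <= n.+1)%N.
  rewrite -ltnS; apply: leq_trans (S n.+1).
  by rewrite -addn1 leq_add2l leq_max.
elim: m => [|m IHm].
  by rewrite big_geq// muln0 expn0 divn1 add0n geq_max leqnn.
apply: leq_trans IHm; rewrite big_nat_recr//= mulnDr -addnA leq_add2l.
rewrite expnSr divnMA; set a := (n.+1 %/ p ^ m)%N.
(* With b = a %/ p, what remains is (p-1) b + max(1, b) <= max(1, a). *)
have [->|b0] := posnP (a %/ p)%N; first by rewrite muln0 leq_maxl.
rewrite (maxn_idPr b0) -[X in (_ + X <= _)%N]mul1n -mulnDl addn1.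
by rewrite prednK ?prime_gt0// leq_max mulnC leq_divM orbT.
Qed.

(** * Absolute values of integers and factorials *)

Section Padic.
Context {R : realType} {K : fieldType} (v : absval R K).
Local Notation Kv := (valued v).
Implicit Types (x y q u : Kv) (n m k N : nat).
Variable p : nat.
Hypothesis p_prime : prime p.
Hypothesis v_p : v (p%:R : Kv) = p%:R^-1.

Lemma v_p_lt1 : v (p%:R : Kv) < 1.
Proof. by rewrite v_p invf_lt1 ?ltr0n ?ltr1n ?prime_gt0 ?prime_gt1. Qed.

(** By Bezout some multiple a m equals 1 + b p, of absolute value 1, while neither |a| nor |m|
    exceeds 1. *)
Lemma v_nat_coprime m : coprime m p -> v (m%:R : Kv) = 1.
Proof.
case: (posnP m) => [->|m0].
  by rewrite /coprime gcd0n => /eqP p1; have := prime_gt1 p_prime; rewrite p1.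
move=> /eqP mp; apply/eqP; rewrite eq_le v_nat_le1/=.
case: (egcdnP p m0) => a b ab _.
have <- : v ((a * m)%:R : Kv) = 1.
  rewrite ab mp addnC natrD v_dom ?v1// natrM vM.
  by rewrite (le_lt_trans _ v_p_lt1)// ler_piMl ?v_ge0 ?v_nat_le1.
by rewrite natrM vM ler_piMl ?v_ge0 ?v_nat_le1.
Qed.

Lemma v_nat m : (0 < m)%N -> v (m%:R : Kv) = p%:R ^- logn p m.
Proof.
move=> m0; have [m' pm' {1}->] := pfactor_coprime p_prime m0.
rewrite natrM vM natrX vX v_p v_nat_coprime ?mul1r ?exprVn//.
by rewrite coprime_sym.
Qed.

Lemma natr_valued_neq0 m : (0 < m)%N -> (m%:R : Kv) != 0.
Proof.
move=> m0; rewrite -v_eq0 v_nat// invr_neq0// expf_neq0//.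
by rewrite pnatr_eq0 -lt0n prime_gt0.
Qed.

Definition exp_radius : R := p%:R `^ (- (p.-1%:R)^-1).
Local Notation rho := exp_radius.

Lemma exp_radius_gt0 : 0 < rho.
Proof. by rewrite powR_gt0// ltr0n prime_gt0. Qed.

Lemma exp_radiusX : rho ^+ p.-1 = p%:R^-1.
Proof.
rewrite -powR_mulrn ?ltW ?exp_radius_gt0// -powRrM mulNr mulVf ?powR_inv1//.
by rewrite pnatr_eq0 -lt0n -subn1 subn_gt0 prime_gt1.
Qed.

Lemma exp_radius_lt1 : rho < 1.
Proof.
rewrite ltNge; apply/negP => /(exprn_ege1 p.-1).
by rewrite exp_radiusX leNgt -v_p v_p_lt1.
Qed.

(** Since rho^(p-1) = 1/p, this is [logn_fact_le] in absolute values. *)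
Lemma v_fact_ge n : rho ^+ n <= v (n.+1`!%:R : Kv).
Proof.
rewrite v_nat ?fact_gt0// -exprVn -exp_radiusX -exprM.
by rewrite ler_wiXn2l ?ltW ?exp_radius_gt0 ?exp_radius_lt1 ?logn_fact_le.
Qed.

Lemma v_fact_le_succ n : v (n.+1`!%:R : Kv) <= v (n.+1%:R : Kv).
Proof. by rewrite factS natrM vM ler_piMr ?v_ge0 ?v_nat_le1. Qed.

Lemma v_succ_ge n : rho ^+ n <= v (n.+1%:R : Kv).
Proof. exact: le_trans (v_fact_ge n) (v_fact_le_succ n). Qed.

(** * Term estimates in the disc of convergence *)

Section Disc.
Variable x : Kv.
Hypothesis x_small : v x < rho.

Lemma ratio_ge0 : 0 <= v x / rho.
Proof. by rewrite divr_ge0 ?v_ge0 ?ltW ?exp_radius_gt0. Qed.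

Lemma ratio_lt1 : v x / rho < 1.
Proof. by rewrite ltr_pdivrMr ?exp_radius_gt0 ?mul1r. Qed.

Lemma v_le_ratio : v x <= v x / rho.
Proof.
rewrite ler_peMr ?v_ge0// invf_ge1 ?exp_radius_gt0//.
exact/ltW/exp_radius_lt1.
Qed.

Lemma disc_le1 : v x <= 1.
Proof. exact: le_trans v_le_ratio (ltW ratio_lt1). Qed.

Lemma v_powdiv_le a n : rho ^+ n <= v (a : Kv) ->
  v (x ^+ n / a) <= (v x / rho) ^+ n.
Proof.
move=> ra; rewrite vM vV vX expr_div_n ler_wpM2l ?exprn_ge0 ?v_ge0//.
have r0 : 0 < rho ^+ n by rewrite exprn_gt0 ?exp_radius_gt0.
by rewrite lef_pV2 ?posrE// (lt_le_trans r0).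
Qed.

(** Here a is (n+1)! for the exponential and n+1 for the logarithm; the shift of the exponent keeps
    a factor |x| outside the ratio. *)
Lemma v_powSdiv_le a n : rho ^+ n <= v (a : Kv) ->
  v (x ^+ n.+1 / a) <= v x * (v x / rho) ^+ n.
Proof.
by move=> ra; rewrite exprS -mulrA vM ler_wpM2l ?v_ge0 ?v_powdiv_le.
Qed.

Lemma v_powSdiv_le_geometric a n : rho ^+ n <= v (a : Kv) ->
  v (x ^+ n.+1 / a) <= (v x / rho) ^+ n.+1.
Proof.
move=> ra; rewrite (le_trans (v_powSdiv_le ra))// exprS.
by rewrite ler_wpM2r ?exprn_ge0 ?ratio_ge0 ?v_le_ratio.
Qed.

Lemma v_powSdiv_le_abs a n : rho ^+ n <= v (a : Kv) ->
  v (x ^+ n.+1 / a) <= v x.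
Proof.
move=> ra; rewrite (le_trans (v_powSdiv_le ra))// ler_piMr ?v_ge0//.
by rewrite exprn_ile1 ?ratio_ge0// ltW ?ratio_lt1.
Qed.

Lemma v_exp_term n : v (x ^+ n / n`!%:R) <= (v x / rho) ^+ n.
Proof.
case: n => [|n]; first by rewrite !expr0 fact0 divr1 v1.
exact: v_powSdiv_le_geometric (v_fact_ge n).
Qed.

End Disc.

Lemma disc_mul a x : v (a : Kv) <= 1 -> v x < rho -> v (a * x) < rho.
Proof. by move=> a1; apply: le_lt_trans; rewrite vM ler_piMl ?v_ge0. Qed.

(** The identity C(m, i+1) = m C(m-1, i) / (i+1) extracts m and leaves the denominators of the
    logarithm series. *)
Lemma pow_expansion m x :
  (1 + x) ^+ m - 1 =
  m%:R * \sum_(i < m) 'C(m.-1, i)%:R * (x ^+ i.+1 / i.+1%:R).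
Proof.
rewrite exprDn big_ord_recl/= !expr1n expr0 mulr1 bin0 mulr1n addrC addKr.
rewrite mulr_sumr; apply: eq_bigr => i _.
rewrite expr1n mul1r -mulr_natr /bump add1n mulrA -natrM mul_bin_diag natrM.
by field; rewrite addrC natr1 natr_valued_neq0.
Qed.

(** With x = u - 1, the quotient ((1 + x)^m - 1) / (m x) is 1 plus terms of absolute value at most
    |x| / rho < 1. *)
Lemma v_pow_sub1 m u : v (u - 1) < rho ->
  v (u ^+ m - 1) = v (m%:R : Kv) * v (u - 1).
Proof.
rewrite -{2}[u](subrK 1) [_ + 1]addrC; move: (u - 1) => x xs.
rewrite pow_expansion vM; case: m => [|m]; first by rewrite v0 !mul0r.
congr (_ * _); rewrite big_ord_recl/= bin0 expr1 divr1 mul1r.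
under eq_bigr do rewrite exprS -mulrA mulrCA.
rewrite -mulr_sumr -[X in X + _]mulr1 -mulrDr vM.
rewrite v_dom ?v1 ?mulr1//; apply: le_lt_trans (ratio_lt1 xs).
apply: v_sum_le => [|i _]; first exact: ratio_ge0.
rewrite vM (le_trans (ler_piMl (v_ge0 _) (v_nat_le1 _ _)))//.
apply: le_trans (v_powdiv_le _ (v_succ_ge _)) _.
by rewrite exprS ler_piMr ?exprn_ile1 ?ratio_ge0// ltW ?ratio_lt1.
Qed.

(** Induction on i by C(m-1, i+1) = C(m, i+1) - C(m-1, i), where C(m, i+1) = m C(m-1, i) / (i+1) is
    small with m. *)
Lemma v_bin_sub_sign m i : (0 < m)%N ->
  v ('C(m.-1, i)%:R - (-1) ^+ i : Kv) <= v (m%:R : Kv) / v (i`!%:R : Kv).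
Proof.
move=> m0; elim: i => [|i IHi].
  by rewrite bin0 subrr v0 divr_ge0 ?v_ge0.
have -> : 'C(m.-1, i.+1)%:R - (-1) ^+ i.+1 =
    'C(m, i.+1)%:R - ('C(m.-1, i)%:R - (-1) ^+ i) :> Kv.
  by rewrite -(prednK m0) binS natrD exprS /=; ring.
have vf k : 0 < v (k%:R : Kv) -> (v (k%:R : Kv))^-1 >= 1.
  by move=> k0; rewrite invf_ge1 ?v_nat_le1.
have vS : 0 < v (i.+1%:R : Kv) by rewrite v_gt0 natr_valued_neq0.
have vi : 0 < v (i`!%:R : Kv) by rewrite v_gt0 natr_valued_neq0 ?fact_gt0.
apply: vB_le; rewrite factS natrM vM invfM.
  have -> : 'C(m, i.+1)%:R = m%:R * 'C(m.-1, i)%:R / i.+1%:R :> Kv.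
    by rewrite -natrM mul_bin_diag natrM mulrC mulKf ?natr_valued_neq0.
  rewrite !vM vV -mulrA ler_wpM2l ?v_ge0//.
  rewrite (le_trans (ler_piMl _ (v_nat_le1 _ _))) ?invr_ge0 ?v_ge0//.
  by rewrite ler_peMr ?vf// invr_ge0 v_ge0.
rewrite (le_trans IHi)// ler_wpM2l ?v_ge0// ler_peMl ?vf// invr_ge0 v_ge0 //.
Qed.

(** * The exponential *)

Hypothesis complete :
  forall F : set_system Kv, ProperFilter F -> cauchy F -> cvg F.

Lemma cvg_padic_exp x : v x < rho ->
  [series x ^+ n / n`!%:R]_n @ \oo --> padic_exp x.
Proof.
move=> xs; apply: (cvg_series_geometric complete (r := v x / rho)).
  by rewrite ratio_ge0 ratio_lt1.
exact: v_exp_term.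
Qed.

Lemma padic_exp_tail x n c : v x < rho ->
  (forall k, (n <= k)%N -> v (x ^+ k / k`!%:R) <= c) ->
  v (padic_exp x - \sum_(0 <= k < n) x ^+ k / k`!%:R) <= c.
Proof. by move=> /cvg_padic_exp/series_lim_tail_le; apply. Qed.

Lemma v_padic_exp_sub1 x : v x < rho -> v (padic_exp x - 1) <= v x.
Proof.
move=> xs; have := @padic_exp_tail x 1 (v x) xs.
rewrite big_nat1 expr0 fact0 divr1; apply=> -[//|k] _.
exact (v_powSdiv_le_abs xs (v_fact_ge k)).
Qed.

(** The terms of index k >= 2 carry a^k, bounded by |a|^2, times x^k / k!, bounded by 1. *)
Lemma padic_exp_linear_approx a x : v (a : Kv) <= 1 -> v x < rho ->
  v (padic_exp (a * x) - 1 - a * x) <= v a ^+ 2.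
Proof.
move=> a1 xs; have := @padic_exp_tail (a * x) 2 (v a ^+ 2) (disc_mul a1 xs).
rewrite big_nat_recr//= big_nat1 expr0 factS fact0 muln1 expr1 !divr1 opprD addrA.
apply=> -[//|[//|k]] _; rewrite exprMn -mulrA vM vX.
rewrite (le_trans (ler_piMr _ (le_trans (v_exp_term _ _) _)))//.
- by rewrite exprn_ge0 ?v_ge0.
- by rewrite exprn_ile1 ?ratio_ge0// ltW ?ratio_lt1.
- by rewrite ler_wiXn2l ?v_ge0.
Qed.

Lemma padic_exp0 : padic_exp (0 : Kv) = 1.
Proof.
have z : v (0 : Kv) < rho by rewrite v0 exp_radius_gt0.
have := v_padic_exp_sub1 z; rewrite v0 => e0.
by apply/eqP; rewrite -subr_eq0 -v_eq0 eq_le v_ge0 e0.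
Qed.

Lemma v_padic_exp x : v x < rho -> v (padic_exp x) = 1.
Proof.
move=> xs; rewrite -[padic_exp x](subrK 1) addrC v_dom ?v1//.
by rewrite (le_lt_trans (v_padic_exp_sub1 xs))// (lt_trans xs) ?exp_radius_lt1.
Qed.

(** Truncations at n satisfy the identity up to r^n, r being the larger of the two ratios to rho;
    then n tends to infinity. *)
Lemma padic_expD x y : v x < rho -> v y < rho ->
  padic_exp (x + y) = padic_exp x * padic_exp y.
Proof.
move=> xs ys; have xys : v (x + y) < rho by exact: vD_lt.
pose r := Num.max (v x / rho) (v y / rho).
have r0 : 0 <= r by rewrite le_max ratio_ge0.
have r1 : r < 1 by rewrite gt_max !ratio_lt1.
have le_r z n : v z / rho <= r -> v (z ^+ n / n`!%:R : Kv) <= r ^+ n.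
  by move=> zr; rewrite (le_trans (v_exp_term _ _))// lerXn2r ?nnegrE ?ratio_ge0.
have xr : v x / rho <= r by rewrite le_max lexx.
have yr : v y / rho <= r by rewrite le_max lexx orbT.
have xyr : v (x + y) / rho <= r.
  rewrite ler_pdivrMr ?exp_radius_gt0//.
  by rewrite vD_le// -ler_pdivrMr ?exp_radius_gt0.
pose E (z : Kv) n := \sum_(0 <= k < n) z ^+ k / k`!%:R.
have tail z n : v z < rho -> v z / rho <= r -> v (padic_exp z - E z n) <= r ^+ n.
  move=> zs zr; apply: padic_exp_tail => // k nk.
  by rewrite (le_trans (le_r _ _ zr))// ler_wiXn2l// ltW.
have E1 z n : v z / rho <= r -> v (E z n) <= 1.
  move=> zr; apply: v_sum_le => // k _; rewrite (le_trans (le_r _ _ zr))//.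
  by rewrite exprn_ile1// ltW.
have prod n : v (E x n * E y n - E (x + y) n) <= r ^+ n.
  (* [E z n] is the value at 1 of [P z], and [P x * P y] has the coefficients of
     [P (x + y)] below degree [n]. *)
  pose P (z : Kv) : {poly Kv} := \poly_(k < n) (z ^+ k / k`!%:R).
  have PE z : E z n = (P z).[1].
    rewrite horner_poly /E big_mkord; apply: eq_bigr => k _.
    by rewrite expr1n mulr1.
  have coefP z k : v z / rho <= r -> v (P z)`_k <= r ^+ k.
    by move=> zr; rewrite coef_poly; case: ifP => _; rewrite ?le_r// v0 exprn_ge0.
  have coefPP k : v (P x * P y)`_k <= r ^+ k.
    rewrite coefM v_sum_le ?exprn_ge0// => -[j jk] _ /=.
    rewrite vM -[X in _ <= _ ^+ X](subnKC (jk : (j <= k)%N)) exprD.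
    by rewrite ler_pM ?v_ge0 ?coefP.
  have coefE k : (k < n)%N -> (P x * P y)`_k = (x + y) ^+ k / k`!%:R.
    move=> kn; rewrite coefM addrC exprDn mulr_suml.
    apply: eq_bigr => -[j jk] _ /=.
    rewrite ltnS in jk.
    rewrite !coef_poly (leq_ltn_trans jk kn) (leq_ltn_trans (leq_subr _ _) kn).
    rewrite -(bin_fact jk) -[_ *+ 'C(k, j)]mulr_natr !natrM.
    have b0 : ('C(k, j)%:R : Kv) != 0 by rewrite natr_valued_neq0 ?bin_gt0.
    have f0 i : (i`!%:R : Kv) != 0 by rewrite natr_valued_neq0 ?fact_gt0.
    by field; rewrite b0 !f0.
  have sz : (size (P x * P y)%R <= n + n)%N.
    rewrite (leq_trans (size_polyMleq _ _))// (leq_trans (leq_pred _))//.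
    by rewrite leq_add ?size_poly.
  rewrite !PE -hornerM (horner_coef_wide _ sz) -PE /E -(big_mkord xpredT
    (fun i => (P x * P y)`_i * 1 ^+ i)).
  rewrite (big_cat_nat _ (n := n))//= ?leq_addr//.
  under eq_big_nat => i /andP[_ ltin] do rewrite expr1n mulr1 coefE//.
  rewrite addrAC subrr add0r big_nat_cond v_sum_le ?exprn_ge0// => i.
  rewrite andbT expr1n mulr1 => /andP[ni _].
  by rewrite (le_trans (coefPP i))// ler_wiXn2l// ltW.
have dist n : v (padic_exp (x + y) - padic_exp x * padic_exp y) <= r ^+ n.
  (* Each of the tails and the truncated defect is at most r^n; the cofactors [padic_exp y] and
     [E x n] have absolute value at most 1. *)
  have -> : padic_exp (x + y) - padic_exp x * padic_exp y =
    (padic_exp (x + y) - E (x + y) n) - (E x n * E y n - E (x + y) n)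
    - ((padic_exp x - E x n) * padic_exp y + E x n * (padic_exp y - E y n)).
    by ring.
  apply: vB_le; first by apply: vB_le; [exact: tail|exact: prod].
  apply: vD_le; rewrite vM.
    by rewrite v_padic_exp// mulr1 tail.
  by rewrite (le_trans (ler_piMl (v_ge0 _) (E1 _ _ xr))) ?tail.
apply/esym/eqP; rewrite -subr_eq0 -v_eq0 v_distC; apply/eqP/le_anti.
rewrite v_ge0 andbT leNgt; apply/negP => d0.
have r01 : 0 <= r < 1 by rewrite r0.
have [N /(_ _ (leqnn N))] := expr_lt_eps r01 d0.
by rewrite ltNge dist.
Qed.

Lemma disc_natM m x : v x < rho -> v (m%:R * x) < rho.
Proof. by apply: disc_mul; exact: v_nat_le1. Qed.

Lemma padic_exp_natM m x : v x < rho -> padic_exp (m%:R * x) = padic_exp x ^+ m.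
Proof.
move=> xs; elim: m => [|m IHm]; first by rewrite mul0r padic_exp0 expr0.
by rewrite -natr1 mulrDl mul1r padic_expD ?disc_natM// IHm exprSr.
Qed.

(** * The logarithm and its inversion by the exponential *)

Section Log.
Variable q : Kv.
Hypothesis q_small : v (q - 1) < rho.

Lemma cvg_padic_log :
  [series (-1) ^+ n * (q - 1) ^+ n.+1 / n.+1%:R]_n @ \oo --> padic_log q.
Proof.
apply: (cvg_series_geometric complete (r := v (q - 1) / rho)).
  by rewrite ratio_ge0 ratio_lt1.
move=> n /=; rewrite -mulrA vM vX vN v1 expr1n mul1r.
apply: le_trans (v_powSdiv_le _ (v_succ_ge n)) _.
by rewrite ler_piMl ?exprn_ge0 ?ratio_ge0 ?disc_le1.
Qed.

Lemma v_padic_log_le : v (padic_log q) <= v (q - 1).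
Proof.
have := series_lim_tail_le (n := 0) (c := v (q - 1)) cvg_padic_log.
rewrite /series/= big_geq// subr0; apply=> n _.
rewrite /= -mulrA vM vX vN v1 expr1n mul1r.
exact (v_powSdiv_le_abs q_small (v_succ_ge n)).
Qed.

Lemma v_padic_log_lt : v (padic_log q) < rho.
Proof. exact: le_lt_trans v_padic_log_le q_small. Qed.

(* By [pow_expansion], ((1 + x)^m - 1) / m is the logarithm series with the sign
   (-1)^i replaced by 'C(m - 1, i), which differs from it by at most |m| / |i!|. *)
Lemma padic_log_approx m : (0 < m)%N ->
  v (q ^+ m - 1 - m%:R * padic_log q) <= v (m%:R : Kv) ^+ 2.
Proof.
move=> m0; rewrite -{1}[q](subrK 1) [_ + 1]addrC pow_expansion -mulrBr vM expr2.
rewrite ler_wpM2l ?v_ge0// v_distC; apply: (cvgn_abs_le cvg_padic_log).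
exists m => n mn; rewrite /series/= big_mkord.
rewrite (big_ord_widen_cond n xpredT (fun i => 'C(m.-1, i)%:R *
  ((q - 1) ^+ i.+1 / i.+1%:R) : Kv))// [X in _ - X]big_mkcond -sumrB /=.
apply: v_sum_le => [|i _]; first exact: v_ge0.
(* For i >= m the coefficient ['C(m.-1, i)] is zero, so the finite sum can be padded to n terms. *)
rewrite (_ : (if _ then _ else _) =
  'C(m.-1, i)%:R * ((q - 1) ^+ i.+1 / i.+1%:R)); last first.
  by case: ltnP => // mi; rewrite bin_small ?mul0r// prednK.
rewrite -mulrA -mulrBl -opprB mulNr vN vM.
rewrite (le_trans (ler_wpM2r (v_ge0 _) (v_bin_sub_sign _ m0)))//.
(* The denominators i! and i+1 merge into (i+1)!, so the estimate of the exponential terms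
   applies. *)
rewrite -mulrA ler_piMr ?v_ge0// mulrC vM vV -mulrA -invfM -vM -natrM.
rewrite -factS -vV -vM (le_trans _ (disc_le1 q_small))//.
exact (v_powSdiv_le_abs q_small (v_fact_ge i)).
Qed.

(* Raising to the power m = p^N contracts distances to 1 by exactly |m|, while
   [q^m] and [exp (log q)^m] both equal [1 + m log q] up to [|m|^2]. *)
Lemma padic_expK : padic_exp (padic_log q) = q.
Proof.
set Q := padic_exp _.
have ls := v_padic_log_lt.
have vq : v q = 1.
  rewrite -[q](subrK 1) addrC v_dom ?v1// (lt_trans q_small)//.
  exact: exp_radius_lt1.
have q0 : q != 0 by rewrite -v_eq0 vq oner_eq0.
(* Puts Q / q in the disc where [v_pow_sub1] applies. *)
have us : v (Q / q - 1) < rho.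
  have -> : Q / q - 1 = (Q - q) / q by rewrite mulrBl divff.
  rewrite vM vV vq invr1 mulr1.
  have -> : Q - q = (Q - 1) - (q - 1) by ring.
  rewrite vD_lt ?vN//; exact: le_lt_trans (v_padic_exp_sub1 ls) ls.
have bound N : v (Q / q - 1) <= v (p%:R : Kv) ^+ N.
  have m0 : (0 < p ^ N)%N by rewrite expn_gt0 prime_gt0.
  have vm0 : 0 < v ((p ^ N)%:R : Kv) by rewrite v_gt0 natr_valued_neq0.
  rewrite -vX -natrX -(ler_pM2l vm0) -v_pow_sub1// expr_div_n.
  have -> : Q ^+ (p ^ N) / q ^+ (p ^ N) - 1 =
      (Q ^+ (p ^ N) - q ^+ (p ^ N)) / q ^+ (p ^ N).
    by rewrite mulrBl divff// expf_neq0.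
  rewrite vM vV vX vq expr1n invr1 mulr1 -expr2.
  have -> : Q ^+ (p ^ N) - q ^+ (p ^ N) =
      (Q ^+ (p ^ N) - 1 - (p ^ N)%:R * padic_log q) -
      (q ^+ (p ^ N) - 1 - (p ^ N)%:R * padic_log q) by ring.
  rewrite vB_le ?padic_log_approx//.
  by rewrite -padic_exp_natM// padic_exp_linear_approx ?v_nat_le1.
have u1 : Q / q - 1 = 0.
  apply/eqP; rewrite -v_eq0; apply/eqP/le_anti.
  rewrite v_ge0 andbT leNgt; apply/negP => d0.
  have p01 : 0 <= v (p%:R : Kv) < 1 by rewrite v_ge0 v_p_lt1.
  have [N /(_ _ (leqnn N))] := expr_lt_eps p01 d0.
  by rewrite ltNge bound.
by move/eqP: u1; rewrite subr_eq0 -(divff q0) => /eqP/(divIf q0).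
Qed.

End Log.

End Padic.

(** * q-Stirling numbers and the q-integral *)

Section QNumbers.
Context {R : realType} {K : fieldType} (v : absval R K) (p : nat).
Local Notation Kv := (valued v).
Hypothesis p_prime : prime p.
Hypothesis v_p : v (p%:R : Kv) = p%:R^-1.
Hypothesis complete :
  forall F : set_system Kv, ProperFilter F -> cauchy F -> cvg F.
Variable q : Kv.
Hypothesis q_neq1 : q != 1.
Hypothesis q_small : v (q - 1) < exp_radius p.

(** By [v_pow_sub1], |q^m - 1| = |m| |q - 1|, and neither factor vanishes. *)
Lemma valued_q_nroot m : (0 < m)%N -> q ^+ m != 1.
Proof.
move=> m0; rewrite -subr_eq0 -v_eq0 (v_pow_sub1 p_prime v_p)//.
by rewrite -vM v_eq0 mulf_neq0 ?subr_eq0 ?(natr_valued_neq0 p_prime v_p).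
Qed.

Lemma valued_q_neq0 : q != 0.
Proof.
apply/negP => /eqP q0; have := lt_trans q_small (exp_radius_lt1 p_prime v_p).
by rewrite q0 sub0r vN v1 ltxx.
Qed.

Lemma qpow_nat m : qpow q m%:R = q ^+ m.
Proof.
rewrite /qpow (padic_exp_natM p_prime v_p complete).
  by rewrite (padic_expK p_prime v_p complete).
exact: v_padic_log_lt p_prime v_p complete _ q_small.
Qed.

Lemma qnum_nat m : qnum q m%:R = qint q m.
Proof. by rewrite /qnum qpow_nat. Qed.

Lemma qfactE n : qfact q n = qint_fact q n.
Proof. by apply: eq_bigr => i _; rewrite qnum_nat. Qed.

Lemma qbinomE n k : (k <= n)%N -> qbinom q n k = gauss q n k.
Proof.
by move=> kn; rewrite gaussE ?/qbinom ?qfactE//; exact: valued_q_nroot.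
Qed.

Lemma qpow_subn x i : v x <= 1 -> qpow q (x - i%:R) = qpow q x / q ^+ i.
Proof.
move=> x1; have ls := v_padic_log_lt p_prime v_p complete q_small.
apply: (mulIf (expf_neq0 i valued_q_neq0)).
rewrite divfK ?expf_neq0 ?valued_q_neq0// -qpow_nat /qpow.
rewrite -(padic_expD p_prime v_p complete) -?mulrDl ?subrK//; apply: disc_mul => //.
  by rewrite vB_le ?v_nat_le1.
exact: v_nat_le1.
Qed.

(** Each [x - i] is q^(-i) ([x] - [i]), and the powers q^(-i) for i < k multiply to q^(-C(k,2)). *)
Lemma qfallingE x k : v x <= 1 ->
  qfalling q x k = q ^- 'C(k, 2) * (qfalling_poly q k).[qnum q x].
Proof.
move=> x1; elim: k => [|k IHk].
  by rewrite /qfalling /qfalling_poly !big_ord0 hornerC mulr1 expr0 invr1.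
rewrite /qfalling /qfalling_poly !big_ord_recr/= -/(qfalling q x k) IHk.
rewrite hornerM hornerXsubC binS bin1 exprD invfM.
have -> : qnum q (x - k%:R) = q ^- k * (qnum q x - qint q k).
  rewrite /qnum /qint qpow_subn//.
  by field; rewrite expf_neq0 ?valued_q_neq0 ?subr1q_neq0.
by rewrite -/(qfalling_poly q k); ring.
Qed.

(** * Existence and uniqueness of the q-Stirling numbers *)

Lemma padic_integer_nat m : padic_integers (m%:R : Kv).
Proof.
split; last exact: v_nat_le1.
by apply: subset_closure; exists m%:R => //; rewrite ratr_nat.
Qed.

Lemma is_qstirling1_coef k :
  is_qstirling1 q k (fun l => (qfalling_poly q k)`_l).
Proof.
move=> x [_ x1]; rewrite qfallingE//; congr (_ * _).
by rewrite horner_coef size_qfalling_poly.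
Qed.

(** Evaluating at x = 0, ..., k gives k+1 distinct roots [x] of a difference of polynomials of
    degree at most k. *)
Lemma is_qstirling1_uniq k c l : is_qstirling1 q k c -> (l <= k)%N ->
  c l = (qfalling_poly q k)`_l.
Proof.
move=> kc lk; pose D := qfalling_poly q k - \poly_(i < k.+1) c i.
suff D0 : D = 0.
  by move/eqP: D0; rewrite subr_eq0 => /eqP ->; rewrite coef_poly ltnS lk.
pose rs := [seq qint q m | m <- iota 0 k.+1].
apply: (@roots_geq_poly_eq0 _ _ rs).
- apply/allP => _ /mapP[m _ ->]; rewrite rootE hornerD hornerN subr_eq0.
  have := kc _ (padic_integer_nat m).
  rewrite qfallingE ?v_nat_le1// horner_poly qnum_nat => /mulfI -> //.
  by rewrite invr_neq0// expf_neq0// valued_q_neq0.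
- rewrite map_inj_uniq ?iota_uniq//; apply: qint_inj; last exact: valued_q_neq0.
  exact: valued_q_nroot.
- rewrite size_map size_iota (leq_trans (size_polyD _ _))// geq_max size_polyN.
  by rewrite size_qfalling_poly leqnn size_poly.
Qed.

Lemma qstirling1E k l : (l <= k)%N ->
  qstirling1 q k l = (qfalling_poly q k)`_l.
Proof.
move=> lk; apply: is_qstirling1_uniq => //; rewrite /qstirling1.
(* Existence rules out the default value of [xget]. *)
by case: xgetP => [c _ //|/(_ _ (is_qstirling1_coef k))].
Qed.

(** * The limit of the means *)

Lemma horner_lipschitz (P : {poly Kv}) : exists2 B : R, 0 <= B &
  forall y : Kv, v y <= 1 -> v (P.[y] - P.[1]) <= B * v (y - 1).
Proof.
have /factor_theorem[Q PQ] : root (P - (P.[1])%:P) 1.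
  by rewrite rootE hornerD hornerN hornerC subrr.
exists (\sum_(i < size Q) v Q`_i) => [|y y1].
  by apply: sumr_ge0 => i _; exact: v_ge0.
have -> : P.[y] - P.[1] = Q.[y] * (y - 1).
  have := congr1 (horner^~ y) PQ.
  by rewrite /= hornerM hornerXsubC hornerD hornerN hornerC.
rewrite vM ler_wpM2r ?v_ge0// horner_coef v_sum_le // => [|i _].
  by apply: sumr_ge0 => i _; exact: v_ge0.
rewrite vM vX (bigD1 i)//= -[X in X <= _]addr0 lerD//; last first.
  by apply: sumr_ge0 => j _; exact: v_ge0.
by rewrite ler_piMr ?v_ge0// exprn_ile1 ?v_ge0.
Qed.

(** |q^(p^N) - 1| = |p|^N |q - 1| tends to 0, and P is Lipschitz at 1 on the closed unit disc. *)
Lemma cvg_horner_qpow (P : {poly Kv}) :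
  (fun N => P.[q ^+ (p ^ N)]) @ \oo --> P.[1].
Proof.
apply/cvgn_absP => e e0; have [B B0 PB] := horner_lipschitz P.
have p01 : 0 <= v (p%:R : Kv) < 1 by rewrite v_ge0 v_p_lt1.
(* The constant B may be 0, whereas B + 1 can be divided by. *)
have B1 : 0 < B + 1 by rewrite ltr_wpDl.
have [N Ne] := expr_lt_eps p01 (divr_gt0 e0 B1).
have r1 := ltW (exp_radius_lt1 p_prime v_p).
exists N => n /Ne; rewrite ltr_pdivlMr// => ne.
have q1 : v q <= 1.
  by rewrite -[q](subrK 1) vD_le ?v1// (le_trans (ltW q_small)).
rewrite (le_lt_trans (PB _ _)) ?vX ?exprn_ile1 ?v_ge0//.
rewrite (v_pow_sub1 p_prime v_p)// natrX vX.
apply: le_lt_trans ne; rewrite mulrC ler_pM ?mulr_ge0 ?exprn_ge0 ?v_ge0//.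
  by rewrite ler_piMr ?exprn_ge0 ?v_ge0// (le_trans (ltW q_small)).
by rewrite lerDl.
Qed.

(** The N-th mean is P(q^(p^N)) for a fixed polynomial P; at the limit P(1) each inner geometric sum
    becomes l + 1. *)
Lemma carlitz_bernoulliE n : carlitz_bernoulli p q n =
  ((1 - q) ^+ n)^-1 * \sum_(l < n.+1)
    'C(n, l)%:R * (-1) ^+ l / qint q l.+1 * l.+1%:R.
Proof.
pose P : {poly Kv} := ((1 - q) ^+ n)^-1 *: \sum_(l < n.+1)
  ('C(n, l)%:R * (-1) ^+ l / qint q l.+1) *: \sum_(j < l.+1) 'X^j.
have PE y : P.[y] = ((1 - q) ^+ n)^-1 * \sum_(l < n.+1)
    'C(n, l)%:R * (-1) ^+ l / qint q l.+1 * \sum_(j < l.+1) y ^+ j.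
  rewrite hornerZ horner_sum; congr (_ * _); apply: eq_bigr => l _.
  rewrite hornerZ horner_sum; congr (_ * _); apply: eq_bigr => j _.
  by rewrite hornerXn.
transitivity P.[1].
  rewrite -(limn_eq (cvg_horner_qpow (P := P))); congr (lim (_ @ \oo)).
  apply/funext => N; rewrite PE qnum_nat -mean_qint_pow; first last.
  - by rewrite expn_gt0 prime_gt0.
  - exact: valued_q_nroot.
  by congr (_ * _); apply: eq_bigr => x _; rewrite qnum_nat qpow_nat.
rewrite PE; congr (_ * _); apply: eq_bigr => l _; congr (_ * _).
by under eq_bigr do rewrite expr1n; rewrite sumr_const card_ord.
Qed.

End QNumbers.

Theorem theorem6 (R : realType) (K : fieldType) (v : absval R K) (p : nat)
    (p_prime : prime p) (K_Cp : isCp v p) (q : valued v) (q_neq1 : q != 1)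
    (q_small : v (q - 1) < p%:R `^ (- (p.-1%:R)^-1)) (n : nat) :
  carlitz_bernoulli p q n =
    ((1 - q) ^+ n)^-1 *
      \sum_(0 <= m < n.+1)
        (\sum_(m <= k < n.+1)
           (q - 1) ^+ (k - m) * qbinom q n k * qstirling1 q k m) *
        (-1) ^+ m * (m.+1%:R / qnum q m.+1%:R).
Proof.
have v_p := Cp_normp K_Cp; have complete := Cp_complete K_Cp.
rewrite (carlitz_bernoulliE p_prime v_p complete)//; congr (_ * _).
rewrite -(big_mkord xpredT (fun l =>
  'C(n, l)%:R * (-1) ^+ l / qint q l.+1 * l.+1%:R)).
apply: eq_big_nat => m /andP[_ mn].
rewrite (qnum_nat p_prime v_p complete)//.
(* For m <= k <= n, [qbinom] and [qstirling1] agree with [gauss] and the coefficients of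
   [qfalling_poly]. *)
have -> : \sum_(m <= k < n.+1)
    (q - 1) ^+ (k - m) * qbinom q n k * qstirling1 q k m = 'C(n, m)%:R.
  rewrite -(sum_gauss_qfalling_poly (valued_q_nroot p_prime v_p q_neq1 q_small))//.
  apply: eq_big_nat => k /andP[mk kn].
  by rewrite (qbinomE p_prime v_p complete)// (qstirling1E p_prime v_p complete).
by rewrite -!mulrA [_^-1 * _]mulrC.
Qed.
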